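(* Consider the network system $\bm\Sigma$ with $N$ agents and its reduced-order network model $\bm{\hat\Sigma}$ with $k$ agents (and agents of reduced order $r$). If $H\mathbf 1_N=0$ or $\mathbf 1_N^\top F=0$, then the approximation error between $\bm\Sigma$ and $\bm{\hat\Sigma}$ is bounded by $$\|\bm\Sigma-\bm{\hat\Sigma}\|_{\mathcal H_\infty}=\|\mathbf{\Sigma_s}-\mathbf{\hat\Sigma_s}\|_{\mathcal H_\infty}\le\gamma,$$ where $$\gamma=2\sum_{i=k}^{N-1}\sum_{j=1}^{n}\sigma_i\tau_j+2\sum_{i=1}^{k-1}\sum_{j=r+1}^{n}\sigma_i\tau_j .$$
   Context: Original data. Agents: $\dot x_i=Ax_i+B\nu_i$, $\eta_i=Cx_i$ with $A\in\mathbb{R}^{n\times n}$, $B\in\mathbb{R}^{n\times m}$, $C\in\mathbb{R}^{m\times n}$, minimal and passive. Passive means that there is a symmetric positive definite $K$ with $A^\top K+KA\le0$, $C=B^\top K$. Let $K_m$, $K_M$ be the minimum and maximum (Loewner order) symmetric positive definite solutions $K$ of these relations. $L\in\mathbb{R}^{N\times N}$ is the Laplacian of a connected undirected weighted graph ($L_{ij}=-w_{ij}$ for $i\neq j$, $L_{ii}=\sum_{j\ne i}w_{ij}$, $w_{ij}=w_{ji}\ge0$), $F\in\mathbb{R}^{N\times p}$, $H\in\mathbb{R}^{q\times N}$; $\mathbf 1_N$ is the all-ones vector. The network system is $$\bm\Sigma:\ \dot x=(I_N\otimes A-L\otimes BC)x+(F\otimes B)u,\quad y=(H\otimes C)x .$$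 Fix $L=T\,\mathrm{blkdiag}(\bar\Lambda,0)T^\top$ with $T=[T_1\ T_2]$ orthogonal, $T_2=\mathbf 1_N/\sqrt N$, $\bar\Lambda=\mathrm{blkdiag}(\bar\lambda_1I_{m_1},\dots,\bar\lambda_sI_{m_s})$ with $\bar\lambda_1>\cdots>\bar\lambda_s>0$ the distinct nonzero eigenvalues of $L$. Set $\bar F=T_1^\top F$, $\bar H=HT_1$, and $$\mathbf{\Sigma_s}:\ \dot z_s=(I_{N-1}\otimes A-\bar\Lambda\otimes BC)z_s+(\bar F\otimes B)u,\quad y_s=(\bar H\otimes C)z_s .$$ Balancing. $X=X^\top>0$ satisfies $-\bar\Lambda X-X\bar\Lambda+\bar F\bar F^\top=0$, and $Y=\mathrm{blkdiag}(Y_1,\dots,Y_s)$, $Y_i=Y_i^\top>0$ in $\mathbb{R}^{m_i\times m_i}$, satisfies $-\bar\Lambda Y-Y\bar\Lambda+\bar H^\top\bar H\le0$. Nonsingular $T_{\mathcal G},T_{\mathcal D}$ satisfy $T_{\mathcal G}XT_{\mathcal G}^\top=T_{\mathcal G}^{-\top}YT_{\mathcal G}^{-1}=\mathrm{diag}(\sigma_1,\dots,\sigma_{N-1})$ and $T_{\mathcal D}K_M^{-1}T_{\mathcal D}^\top=T_{\mathcal D}^{-\top}K_mT_{\mathcal D}^{-1}=\mathrm{diag}(\tau_1,\dots,\tau_n)$, with $\sigma_1\ge\cdots\ge\sigma_{N-1}$ and $\tau_1\ge\cdots\ge\tau_n$. Truncation to $k\le N$ nodes and agent order $r\le n$. $(\hat\Lambda_1,\hat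 F_1,\hat H_1)$ consists of the leading $(k-1)\times(k-1)$ block of $T_{\mathcal G}\bar\Lambda T_{\mathcal G}^{-1}$, the first $k-1$ rows of $T_{\mathcal G}\bar F$, and the first $k-1$ columns of $\bar HT_{\mathcal G}^{-1}$. $(\hat A,\hat B,\hat C)$ consists of the leading $r\times r$ block of $T_{\mathcal D}AT_{\mathcal D}^{-1}$, the first $r$ rows of $T_{\mathcal D}B$, and the first $r$ columns of $CT_{\mathcal D}^{-1}$ (it may be replaced by a minimal realization, which does not change transfer functions). Then $$\mathbf{\hat\Sigma_s}:\ \dot{\hat z}_s=(I_{k-1}\otimes\hat A-\hat\Lambda_1\otimes\hat B\hat C)\hat z_s+(\hat F_1\otimes\hat B)u,\quad \hat y_s=(\hat H_1\otimes\hat C)\hat z_s .$$ Reduced network. Put $$\mathcal N=\begin{bmatrix}\hat\Lambda_1&0\\0&0\end{bmatrix},\quad \mathcal F=\begin{bmatrix}\hat F_1\\ \tfrac1{\sqrt N}\mathbf 1_N^\top F\end{bmatrix},\quad \mathcal H=\begin{bmatrix}\hat H_1&\tfrac1{\sqrt N}H\mathbf 1_N\end{bmatrix}.$$ $\mathcal T_n$ is a nonsingular matrix such that $\hat L=\mathcal T_n^{-1}\mathcal N\mathcal T_n$ is the Laplacian of a connected undirected weighted graph on $k$ nodes, $\hat F=\mathcal T_n^{-1}\mathcal F$, $\hat H=\mathcal H\mathcal T_n$, and $$\bm{\hat\Sigma}:\ \dot{\hat x}=(I_k\otimes\hat A-\hat L\otimes\hat B\hat C)\hat x+(\hat F\otimes\hat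 B)u,\quad \hat y=(\hat H\otimes\hat C)\hat x .$$ $\|\bm\Sigma_1-\bm\Sigma_2\|_{\mathcal H_\infty}$ denotes the $\mathcal H_\infty$-norm of the difference of the transfer functions (from $u$ to output) of the two systems, taken as a rational matrix function after cancellations. *)

(* Defs.v *)
From HB Require Import structures.
From mathcomp Require Import all_boot all_order all_algebra.
From mathcomp Require Import all_classical all_reals ereal.
From mathcomp Require Import complex mxtens. (* [*t] is the Kronecker product *)

Set Implicit Arguments.
Unset Strict Implicit.
Unset Printing Implicit Defensive.

Import Order.TTheory GRing.Theory Num.Theory.
Local Open Scope classical_set_scope.
Local Open Scope ring_scope.

Section Matrices.
Variable R : realType.

Definition psdmx n (M : 'M[R]_n) : Prop :=
  M^T = M /\ forall x : 'cV[R]_n, 0 <= (x^T *m M *m x) 0 0.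

Definition posdefmx n (M : 'M[R]_n) : Prop :=
  M^T = M /\ forall x : 'cV[R]_n, x != 0 -> 0 < (x^T *m M *m x) 0 0.

Definition loewner_le n (M1 M2 : 'M[R]_n) : Prop := psdmx (M2 - M1).

Definition ones n : 'cV[R]_n := const_mx 1.

Definition nonincreasing_diag n (d : 'rV[R]_n) : Prop :=
  forall i j : 'I_n, (i <= j)%N -> d 0 j <= d 0 i.

(* The diagonal weights [w i i] play no role. *)
Definition connected_laplacian n (L : 'M[R]_n) : Prop :=
  exists w : 'I_n -> 'I_n -> R,
    [/\ forall i j, w i j = w j i,
        forall i j, 0 <= w i j,
        forall i j, connect (fun a b => 0 < w a b) i j &
        L = \matrix_(i, j)
              (if i == j then \sum_(l | l != i) w i l else - w i j)].

End Matrices.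

(* The system  x' = A x + B u,  y = C x  with p inputs and q outputs. *)
Record lti (R : realType) (p q : nat) := LTI {
  lti_order : nat;
  lti_A : 'M[R]_lti_order;
  lti_B : 'M[R]_(lti_order, p);
  lti_C : 'M[R]_(q, lti_order)
}.

Section Systems.
Variable R : realType.

Definition ratfun := {fraction {poly R}}.

Definition const_ratfun (a : R) : ratfun := FracField.tofrac a%:P.

(* C (sI - A)^-1 B as a matrix of rational functions; [char_poly_mx A] is
   sI - A, which is invertible over the fraction field. *)
Definition transfer p q (S : lti R p q) : 'M[ratfun]_(q, p) :=
  map_mx const_ratfun (lti_C S)
    *m invmx (map_mx (@FracField.tofrac _) (char_poly_mx (lti_A S)))
    *m map_mx const_ratfun (lti_B S).

Definition minimal p q (S : lti R p q) : Prop :=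
  forall S' : lti R p q,
    transfer S' = transfer S -> (lti_order S <= lti_order S')%N.

Inductive same_or_minimal_realization p q (S : lti R p q) :
    lti R p q -> Prop :=
| SameRealization : same_or_minimal_realization S S
| MinimalRealization S' :
    minimal S' -> transfer S' = transfer S -> same_or_minimal_realization S S'.

Definition passivity_certificate m (S : lti R m m)
    (K : 'M[R]_(lti_order S)) : Prop :=
  [/\ posdefmx K,
      loewner_le ((lti_A S)^T *m K + K *m lti_A S) 0 &
      lti_C S = (lti_B S)^T *m K].

Definition passive m (S : lti R m m) : Prop :=
  exists K, @passivity_certificate m S K.

Definition minimum_certificate m (S : lti R m m)
    (K : 'M[R]_(lti_order S)) : Prop :=
  passivity_certificate K /\
  forall K', passivity_certificate K' -> loewner_le K K'.

Definition maximum_certificate m (S : lti R m m)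
    (K : 'M[R]_(lti_order S)) : Prop :=
  passivity_certificate K /\
  forall K', passivity_certificate K' -> loewner_le K' K.

Definition network N p q m (L : 'M[R]_N) (F : 'M[R]_(N, p)) (H : 'M[R]_(q, N))
    (S : lti R m m) : lti R (p * m) (q * m) :=
  LTI (1%:M *t lti_A S - L *t (lti_B S *m lti_C S))
      (F *t lti_B S)
      (H *t lti_C S).

(* Coordinates z = T x, keeping the first r entries of z. *)
Definition truncation p q n r (le_rn : (r <= n)%N) (T A : 'M[R]_n)
    (B : 'M[R]_(n, p)) (C : 'M[R]_(q, n)) : lti R p q :=
  LTI (mxsub (widen_ord le_rn) (widen_ord le_rn) (T *m A *m invmx T))
      (rowsub (widen_ord le_rn) (T *m B))
      (colsub (widen_ord le_rn) (C *m invmx T)).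

End Systems.

Section HinfNorm.
Variable R : realType.
Local Notation C := (complex R).
Local Open Scope ereal_scope.

(* Numerator and denominator after cancellation of common factors. *)
Definition ratfun_num (f : ratfun R) : {poly R} :=
  (\n_(repr f) %/ gcdp \n_(repr f) \d_(repr f))%R.
Definition ratfun_den (f : ratfun R) : {poly R} :=
  (\d_(repr f) %/ gcdp \n_(repr f) \d_(repr f))%R.

Definition horner_complex (P : {poly R}) (s : C) : C :=
  (map_poly (real_complex R) P).[s]%R.

Definition is_pole (f : ratfun R) (s : C) : bool :=
  (horner_complex (ratfun_den f) s == 0)%R.

Definition ratfun_eval (s : C) (f : ratfun R) : C :=
  (horner_complex (ratfun_num f) s / horner_complex (ratfun_den f) s)%R.

Definition l2norm n (v : 'cV[C]_n) : R :=
  Num.sqrt (\sum_i (complex.Re (v i 0) ^+ 2 + complex.Im (v i 0) ^+ 2))%R.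

(* Largest singular value, i.e. the norm induced by the Euclidean norms;
   zero vectors are allowed so that the supremum is over a nonempty set. *)
Definition spectral_norm q p (M : 'M[C]_(q, p)) : \bar R :=
  ereal_sup [set (l2norm (M *m v))%:E | v in [set v | (l2norm v <= 1)%R]].

(* The Hardy-space norm: supremum over the open right half-plane, +oo as soon
   as some entry has a pole there.  For a proper rational matrix without poles
   in the closed right half-plane it is the supremum over the imaginary axis. *)
Definition Hinf_norm q p (G : 'M[ratfun R]_(q, p)) : \bar R :=
  ereal_sup
    [set (if [exists i, exists j, is_pole (G i j) s] then +oo
          else spectral_norm (map_mx (ratfun_eval s) G))
    | s in [set s : C | (0 < complex.Re s)%R]].

End HinfNorm.

(* Main.v *)
Require Import Defs.
From HB Require Import structures.
From mathcomp Require Import all_boot all_order all_algebra.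
From mathcomp Require Import all_classical all_reals ereal.
From mathcomp Require Import complex mxtens.
From mathcomp Require Import generic_quotient ring lra.

(** The two networks have one consensus mode each, spanned by the all-ones
    vector, on which they act as a single agent weighted by
    (H 1)(1^T F) / N.  When H 1 = 0 or 1^T F = 0 this mode is unobservable or
    uncontrollable, so the transfer matrix of each network equals that of its
    part without the mode ([network_intertwine]); the equality of the norms
    follows.

    The inequality is the error bound of balanced truncation.  In the coordinates
    T_G (x) T_D the diagonal matrix D = diag(sigma_i tau_j) is a generalized
    controllability and observability Gramian of Sigma_s: passivity gives
    C K_M^-1 = B^T and B^T K_m = C, by which the coupling term matches the input
    and output terms, and the Lyapunov expressions of the network become sums of
    Kronecker products of semidefinite matrices ([network_ctr_lmi],
    [network_obs_lmi]).  The reduced system keeps the states (i, j) with i < k - 1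
    and j < r ([network_truncation]; replacing the agent by a minimal realization
    changes nothing by [network_transfer_agent]), and gamma is twice the sum of the
    discarded sigma_i tau_j ([sum_discarded]).

    The bound 2 (sum of the discarded d_l) is proved at each complex frequency s
    with Re s > 0 ([Hinf_balanced_truncation]).  States are removed one at a time.
    If x and xh are the states before and after the removal of state l, the
    storage function (x - xh)^T D (x - xh) + d_l^2 (x + xh)^T D^-1 (x + xh)
    satisfies the dissipation inequality with supply rate
    4 d_l^2 |u|^2 - |y - yh|^2 ([one_state_dissipation]).  Along signals
    proportional to e^(st) its derivative is 2 Re s times a nonnegative number,
    hence |y - yh| <= 2 d_l |u|.  The norm is the supremum over this half-plane, so
    the pointwise bound passes to it directly. *)

Set Implicit Arguments.
Unset Strict Implicit.
Unset Printing Implicit Defensive.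

Import Order.TTheory GRing.Theory Num.Theory.
Local Open Scope ring_scope.

Local Notation cmx := (map_mx (real_complex _)).

(** * Values of rational functions and the norm of a difference *)

Section Rational.
Local Open Scope quotient_scope.
Variable R : realType.
Local Notation "x %:F" := (FracField.tofrac x).
Local Notation C := (complex R).

Lemma frac_numden (f : ratfun R) : f * (\d_(repr f))%:F = (\n_(repr f))%:F.
Proof.
have tofracE (z : {poly R}) : z%:F = \pi_(FracField.type {poly R}) (Ratio z 1).
  by unlock FracField.tofrac.
rewrite !tofracE -{1}[f]reprK; set x := repr f.
have d0 : \d_x != 0 by exact: denom_ratioP.
change (FracField.mul (\pi_(FracField.type {poly R}) x)
    (\pi_(FracField.type {poly R}) (Ratio \d_x 1)) =
  \pi_(FracField.type {poly R}) (Ratio \n_x 1)).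
rewrite -FracField.pi_mul; apply/eqmodP.
rewrite /= FracField.equivfE /FracField.mulf !numden_Ratio ?mulr1 ?oner_eq0 //.
by rewrite mulrC.
Qed.

Lemma horner_complexM (P Q : {poly R}) (s : C) :
  horner_complex (P * Q) s = horner_complex P s * horner_complex Q s.
Proof. by rewrite /horner_complex rmorphM hornerM. Qed.

(** Cancelling common factors can only remove poles, so any quotient
    representing [f] whose denominator does not vanish at [s] computes the
    value of [f] at [s].  The cancelled denominator divides [Q] by Gauss's
    lemma. *)
Lemma ratfun_eval_quotient (f : ratfun R) (P Q : {poly R}) (s : C) :
  f * Q%:F = P%:F -> horner_complex Q s != 0 ->
  is_pole f s = false /\
  ratfun_eval s f = horner_complex P s / horner_complex Q s.
Proof.
move=> fQ Qs; rewrite /is_pole /ratfun_eval /ratfun_num /ratfun_den.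
have d0 : \d_(repr f) != 0 by exact: denom_ratioP.
have nd := frac_numden f.
set nn := \n_(repr f) in nd *; set dd := \d_(repr f) in d0 nd *.
have E : nn * Q = dd * P.
  apply/eqP; rewrite -(@tofrac_eq {poly R}) !tofracM -fQ -nd; apply/eqP.
  by rewrite mulrCA mulrA.
have g0 : gcdp nn dd != 0 by rewrite gcdp_eq0 negb_and d0 orbT.
have E' : (nn %/ gcdp nn dd) * Q = (dd %/ gcdp nn dd) * P.
  apply: (mulIf g0); rewrite mulrAC divpK ?dvdp_gcdl // E.
  by rewrite [in RHS]mulrAC divpK ?dvdp_gcdr.
have dQ : (dd %/ gcdp nn dd) %| Q.
  have cop : coprimep (dd %/ gcdp nn dd) (nn %/ gcdp nn dd).
    by rewrite coprimep_sym coprimep_div_gcd // d0 orbT.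
  by rewrite -(Gauss_dvdpr _ cop) E' dvdp_mulr.
have ds : horner_complex (dd %/ gcdp nn dd) s != 0.
  move: Qs; rewrite -(divpK dQ) horner_complexM mulf_eq0 negb_or.
  by case/andP.
split; first exact/negbTE.
have := congr1 (fun r => horner_complex r s) E'; rewrite !horner_complexM => E2.
by apply/eqP; rewrite eqr_div // E2 mulrC.
Qed.

Definition eval_at (s : C) : {poly R} -> C :=
  horner_eval s \o map_poly (real_complex R).

HB.instance Definition _ s := GRing.RMorphism.on (eval_at s).

Lemma eval_atC (s : C) (a : R) : eval_at s a%:P = real_complex R a.
Proof. by rewrite /eval_at /= map_polyC /horner_eval hornerC. Qed.

Lemma map_eval_at_polyC (s : C) a b (M : 'M[R]_(a, b)) :
  map_mx (eval_at s) (map_mx polyC M) = cmx M.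
Proof. by apply/matrixP => i j; rewrite !mxE eval_atC. Qed.

Lemma map_eval_at_char_poly_mx (s : C) n (A : 'M[R]_n) :
  map_mx (eval_at s) (char_poly_mx A) = s%:M - cmx A.
Proof.
rewrite map_mxB map_eval_at_polyC map_scalar_mx; congr (_%:M - _).
change (horner_eval s (map_poly (real_complex R) 'X) = s).
by rewrite map_polyX /horner_eval hornerX.
Qed.

Variables p q : nat.

(** Writing (sI - A)^-1 as adjugate over determinant gives all entries of the
    transfer matrix the polynomial denominator [char_poly A]. *)
Definition transfer_num (S : lti R p q) : 'M[{poly R}]_(q, p) :=
  map_mx polyC (lti_C S) *m \adj (char_poly_mx (lti_A S))
    *m map_mx polyC (lti_B S).

Lemma transfer_numE (S : lti R p q) :
  (char_poly (lti_A S))%:F *: transfer S =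
  map_mx (@FracField.tofrac _) (transfer_num S).
Proof.
have cF k l (M : 'M[R]_(k, l)) :
    map_mx (@const_ratfun R) M = map_mx (@FracField.tofrac _) (map_mx polyC M).
  by apply/matrixP => i j; rewrite !mxE.
have c0 : (char_poly (lti_A S))%:F != 0.
  by rewrite tofrac_eq0 monic_neq0 ?char_poly_monic.
rewrite /transfer /transfer_num !map_mxM map_mx_adj -!cF /invmx.
rewrite unitmxE det_map_mx -/(char_poly _) unitfE c0.
by rewrite -scalemxAr -scalemxAl scalerA mulfV ?scale1r.
Qed.

(** In the frequency domain: if the input u e^(st) drives the system along
    x e^(st), then the output amplitude C x is the value of the transfer matrix
    at [s] applied to u. *)
Lemma transfer_num_response (S : lti R p q) (s : C) (u : 'cV[C]_p)
    (x : 'cV[C]_(lti_order S)) :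
  s *: x = cmx (lti_A S) *m x + cmx (lti_B S) *m u ->
  map_mx (eval_at s) (transfer_num S) *m u =
  eval_at s (char_poly (lti_A S)) *: (cmx (lti_C S) *m x).
Proof.
move=> xE; rewrite !map_mxM map_mx_adj !map_eval_at_polyC -!mulmxA.
have -> : cmx (lti_B S) *m u =
    map_mx (eval_at s) (char_poly_mx (lti_A S)) *m x.
  by rewrite map_eval_at_char_poly_mx mulmxBl mul_scalar_mx xE addrC addKr.
by rewrite [\adj _ *m _]mulmxA mul_adj_mx det_map_mx mul_scalar_mx scalemxAr.
Qed.

Lemma char_poly_eval_neq0 n (A : 'M[R]_n) (s : C) :
  (forall x : 'cV[C]_n, s *: x = cmx A *m x -> x = 0) ->
  eval_at s (char_poly A) != 0.
Proof.
move=> inj; rewrite -det_map_mx map_eval_at_char_poly_mx -det_tr.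
apply/det0P => -[v v0 /(congr1 trmx)]; rewrite trmx_mul trmxK trmx0.
rewrite mulmxBl mul_scalar_mx => /eqP; rewrite subr_eq0 => /eqP/inj.
by move=> /eqP; rewrite trmx_eq0 (negPf v0).
Qed.

Lemma response_exists n (A : 'M[R]_n) (s : C) (b : 'cV[C]_n) :
  eval_at s (char_poly A) != 0 ->
  exists x : 'cV[C]_n, s *: x = cmx A *m x + b.
Proof.
rewrite -det_map_mx map_eval_at_char_poly_mx => d0.
exists (invmx (s%:M - cmx A) *m b).
apply/eqP; rewrite [X in _ == X]addrC -subr_eq -mul_scalar_mx -mulmxBl.
by rewrite mulKVmx.
Qed.

Definition csqnorm k (v : 'cV[C]_k) : R :=
  \sum_i (complex.Re (v i 0) ^+ 2 + complex.Im (v i 0) ^+ 2).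

Lemma csqnorm_ge0 k (v : 'cV[C]_k) : 0 <= csqnorm v.
Proof. by apply: sumr_ge0 => i _; rewrite addr_ge0 ?sqr_ge0. Qed.

(** Reduces a bound on the norm of a difference of transfer matrices to a
    statement about single complex frequencies in which no rational function
    occurs: solve the two state equations at [s] and compare the outputs. *)
Lemma Hinf_norm_le (S1 S2 : lti R p q) (g : R) : 0 <= g ->
  (forall s : C, 0 < complex.Re s ->
    [/\ forall x : 'cV[C]_(lti_order S1), s *: x = cmx (lti_A S1) *m x -> x = 0,
        forall x : 'cV[C]_(lti_order S2), s *: x = cmx (lti_A S2) *m x -> x = 0 &
        forall (u : 'cV[C]_p) (x1 : 'cV[C]_(lti_order S1))
            (x2 : 'cV[C]_(lti_order S2)),
          s *: x1 = cmx (lti_A S1) *m x1 + cmx (lti_B S1) *m u ->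
          s *: x2 = cmx (lti_A S2) *m x2 + cmx (lti_B S2) *m u ->
          csqnorm (cmx (lti_C S1) *m x1 - cmx (lti_C S2) *m x2)
            <= g ^+ 2 * csqnorm u]) ->
  (Hinf_norm (transfer S1 - transfer S2) <= g%:E)%E.
Proof.
move=> g0 H; apply: ge_ereal_sup => _ [s /= s0 <-].
have [/char_poly_eval_neq0 D1 /char_poly_eval_neq0 D2 bound] := H s s0.
set chi1 := char_poly (lti_A S1) in D1; set chi2 := char_poly (lti_A S2) in D2.
pose P := chi2 *: transfer_num S1 - chi1 *: transfer_num S2.
have PE i j : (transfer S1 - transfer S2) i j * (chi1 * chi2)%:F = (P i j)%:F.
  move: (transfer_numE S1) (transfer_numE S2).
  rewrite /P -/chi1 -/chi2; move: (transfer S1) (transfer S2) => G1 G2.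
  move: (transfer_num S1) (transfer_num S2) => M1 M2.
  move=> /matrixP/(_ i j) + /matrixP/(_ i j).
  rewrite !mxE => E1 E2; rewrite tofracB !tofracM -E1 -E2 mulrBl.
  by congr (_ - _); rewrite mulrC -mulrA // mulrCA.
have Q0 : horner_complex (chi1 * chi2) s != 0.
  by rewrite horner_complexM mulf_neq0.
have QE i j := ratfun_eval_quotient (PE i j) Q0.
case: ifPn => [/existsP[i /existsP[j]]|_]; first by rewrite (QE i j).1.
apply: ge_ereal_sup => _ [u /= u1 <-]; rewrite lee_fin.
have [x1 xE1] := response_exists (cmx (lti_B S1) *m u) D1.
have [x2 xE2] := response_exists (cmx (lti_B S2) *m u) D2.
have -> : map_mx (ratfun_eval s) (transfer S1 - transfer S2) *m u =
    cmx (lti_C S1) *m x1 - cmx (lti_C S2) *m x2.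
  have -> : map_mx (ratfun_eval s) (transfer S1 - transfer S2) =
      (eval_at s (chi1 * chi2))^-1 *: map_mx (eval_at s) P.
    by apply/matrixP => i j; rewrite mxE (QE i j).2 !mxE mulrC.
  rewrite -scalemxAl map_mxB !map_mxZ mulmxBl -!scalemxAl.
  rewrite (transfer_num_response xE1) (transfer_num_response xE2).
  rewrite -/chi1 -/chi2 !scalerA [eval_at s chi2 * _]mulrC -rmorphM -scalerBr.
  by rewrite scalerA mulVf ?scale1r // rmorphM mulf_neq0.
have := bound _ _ _ xE1 xE2.
set y := _ - _ => le_y; rewrite -[l2norm _]/(Num.sqrt (csqnorm y)).
have le_u : csqnorm u <= 1.
  rewrite -(@ler_sqrt _ _ 1) // sqrtr1; exact: u1.
rewrite -[g]ger0_norm // -sqrtr_sqr ler_wsqrtr //; apply: le_trans le_y _.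
by rewrite ler_piMr ?sqr_ge0.
Qed.
End Rational.

(** * Kronecker products and transfer matrices of networks *)

Section Tensor.
Variable R : comPzRingType.

Lemma tensmxDl a b c e (M1 M2 : 'M[R]_(a, b)) (N : 'M[R]_(c, e)) :
  (M1 + M2) *t N = M1 *t N + M2 *t N.
Proof. by apply/matrixP => i j; rewrite !mxE mulrDl. Qed.

Lemma tensmxDr a b c e (M : 'M[R]_(a, b)) (N1 N2 : 'M[R]_(c, e)) :
  M *t (N1 + N2) = M *t N1 + M *t N2.
Proof. by apply/matrixP => i j; rewrite !mxE mulrDr. Qed.

Lemma tensmxNl a b c e (M : 'M[R]_(a, b)) (N : 'M[R]_(c, e)) :
  (- M) *t N = - (M *t N).
Proof. by apply/matrixP => i j; rewrite !mxE mulNr. Qed.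

Lemma tensmxNr a b c e (M : 'M[R]_(a, b)) (N : 'M[R]_(c, e)) :
  M *t (- N) = - (M *t N).
Proof. by apply/matrixP => i j; rewrite !mxE mulrN. Qed.

Definition tens_diag a b (x : 'rV[R]_a) (y : 'rV[R]_b) : 'rV[R]_(a * b) :=
  \row_k (x 0 (mxtens_unindex k).1 * y 0 (mxtens_unindex k).2).

Lemma tens_diag_mx a b (x : 'rV[R]_a) (y : 'rV[R]_b) :
  diag_mx x *t diag_mx y = diag_mx (tens_diag x y).
Proof.
apply/matrixP => k l; case: (mxtens_indexP k) => i j.
case: (mxtens_indexP l) => i' j'; rewrite tensmxE !mxE mxtens_indexK /=.
rewrite (inj_eq (can_inj (@mxtens_indexK _ _))) xpair_eqE.
by do 2 case: eqP => _; rewrite ?mulr1n ?mulr0n ?mulr0 ?mul0r.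
Qed.

Lemma tens_scalar_scalar_mx a b (x y : R) :
  x%:M *t y%:M = (x * y)%:M :> 'M[R]_(a * b).
Proof.
rewrite -!diag_const_mx tens_diag_mx; congr diag_mx.
by apply/rowP => k; rewrite !mxE.
Qed.
End Tensor.

(** Seen from the agents' ports, the agents Phi, B, C enter the closed loop only
    through G = C Phi^-1 B.  The matrix I + L (x) G is invertible because
    I - Z (L (x) I) is its inverse, where Z is the left-hand side. *)
Lemma tens_push_through (K : fieldType) N n m (Phi : 'M[K]_n)
    (B : 'M[K]_(n, m)) (C : 'M[K]_(m, n)) (L : 'M[K]_N) :
  Phi \in unitmx -> 1%:M *t Phi + L *t (B *m C) \in unitmx ->
  (1%:M *t C) *m invmx (1%:M *t Phi + L *t (B *m C)) *m (1%:M *t B) =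
  invmx (1%:M + L *t (C *m invmx Phi *m B)) *m (1%:M *t (C *m invmx Phi *m B)).
Proof.
move=> Phi_unit; set M := (_ + _); set G := C *m invmx Phi *m B => M_unit.
set Z := LHS.
have ZE : (1%:M + L *t G) *m Z = 1%:M *t G.
  have <- : (1%:M *t (C *m invmx Phi)) *m (M *m (invmx M *m (1%:M *t B)))
      = 1%:M *t G.
    by rewrite mulKVmx // tensmx_mul mul1mx.
  rewrite /Z !mulmxA; congr (_ *m _ *m _); rewrite mulmxDl mul1mx /M.
  rewrite mulmxDr !tensmx_mul !mul1mx mulmx1 mulmxKV //.
  by rewrite /G !mulmxA.
have U : 1%:M + L *t G \in unitmx.
  have /mulmx1_unit[//] :
      (1%:M + L *t G) *m (1%:M - Z *m (L *t 1%:M)) = 1%:M.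
  by rewrite mulmxBr mulmx1 mulmxA ZE tensmx_mul mul1mx mulmx1 addrK.
by rewrite -ZE mulKmx.
Qed.

Section TransferEq.
Variable R : realType.
Local Notation K := (ratfun R).
Local Notation "x %:F" := (FracField.tofrac x).

(** [const_ratfun] as a composite of ring morphisms, which makes it one. *)
Definition const_frac : R -> K := @FracField.tofrac {poly R} \o polyC.
HB.instance Definition _ := GRing.RMorphism.on const_frac.

Lemma const_ratfunE : @const_ratfun R =1 const_frac.
Proof. by []. Qed.

Local Notation kmx := (map_mx const_frac).

Definition resolvent n (A : 'M[R]_n) : 'M[K]_n := invmx (('X%:F)%:M - kmx A).

Lemma sub_mx_unit n (A : 'M[R]_n) : ('X%:F)%:M - kmx A \in unitmx.
Proof.
have -> : ('X%:F)%:M - kmx A =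
    map_mx (@FracField.tofrac _) (char_poly_mx A).
  rewrite map_mxB map_scalar_mx; congr (_ - _).
  by apply/matrixP => i j; rewrite !mxE.
rewrite unitmxE det_map_mx -/(char_poly _) unitfE tofrac_eq0.
by rewrite monic_neq0 ?char_poly_monic.
Qed.

Lemma transferE p q (S : lti R p q) :
  transfer S = kmx (lti_C S) *m resolvent (lti_A S)
    *m kmx (lti_B S).
Proof.
rewrite /transfer /resolvent map_mxB map_scalar_mx -map_mx_comp.
by rewrite (eq_map_mx const_frac const_ratfunE) (eq_map_mx const_frac const_ratfunE).
Qed.

(** If E intertwines the two dynamics then it intertwines the resolvents.  This
    covers at once changes of coordinates (E invertible), the restriction to a
    controllable subspace (E injective) and the passage to an observable
    quotient (E surjective). *)
Lemma transfer_intertwine p q (S1 S2 : lti R p q)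
    (E : 'M[R]_(lti_order S1, lti_order S2)) :
  lti_A S1 *m E = E *m lti_A S2 -> lti_B S1 = E *m lti_B S2 ->
  lti_C S1 *m E = lti_C S2 -> transfer S1 = transfer S2.
Proof.
move=> AE BE CE; rewrite !transferE BE -CE !map_mxM -!mulmxA; congr (_ *m _).
rewrite !mulmxA; congr (_ *m _).
apply: (canLR (mulKmx (sub_mx_unit _))); rewrite mulmxA.
apply: (canRL (mulmxK (sub_mx_unit _))).
by rewrite mulmxBl mulmxBr mul_scalar_mx mul_mx_scalar -!map_mxM AE.
Qed.

Lemma network_intertwine p q m N1 N2 (L1 : 'M[R]_N1) (F1 : 'M[R]_(N1, p))
    (H1 : 'M[R]_(q, N1)) (L2 : 'M[R]_N2) (F2 : 'M[R]_(N2, p))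
    (H2 : 'M[R]_(q, N2)) (S1 S2 : lti R m m) (E : 'M[R]_(N1, N2))
    (T : 'M[R]_(lti_order S1, lti_order S2)) :
  L1 *m E = E *m L2 -> F1 = E *m F2 -> H1 *m E = H2 ->
  lti_A S1 *m T = T *m lti_A S2 -> lti_B S1 = T *m lti_B S2 ->
  lti_C S1 *m T = lti_C S2 ->
  transfer (network L1 F1 H1 S1) = transfer (network L2 F2 H2 S2).
Proof.
move=> LE FE HE AT BT CT; apply: (@transfer_intertwine _ _ (network L1 F1 H1 S1)
  (network L2 F2 H2 S2) (E *t T)) => /=.
- rewrite mulmxBl mulmxBr !tensmx_mul mul1mx mulmx1 AT LE BT -CT.
  by rewrite !mulmxA.
- by rewrite tensmx_mul -FE -BT.
- by rewrite tensmx_mul HE CT.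
Qed.

Lemma network_transfer p q m N (L : 'M[R]_N) (F : 'M[R]_(N, p))
    (H : 'M[R]_(q, N)) (S : lti R m m) :
  transfer (network L F H S) =
  (kmx H *t 1%:M) *m invmx (1%:M + kmx L *t transfer S)
    *m (1%:M *t transfer S) *m (kmx F *t 1%:M).
Proof.
rewrite [LHS]transferE /=; set G := transfer S.
set A := lti_A S; set B := kmx (lti_B S).
set C := kmx (lti_C S).
set M := resolvent _; pose Phi := ('X%:F)%:M - kmx A.
have GE : G = C *m invmx Phi *m B by rewrite /G transferE.
have ME : ('X%:F)%:M - kmx (1%:M *t A - L *t (lti_B S *m lti_C S)) =
    1%:M *t Phi + kmx L *t (B *m C).
  rewrite map_mxB !map_mxT map_mx1 map_mxM opprB addrA addrAC; congr (_ + _).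
  by rewrite -tensmxNr -['X%:F in LHS]mul1r -tens_scalar_scalar_mx -tensmxDr.
have Phi_unit : Phi \in unitmx by exact: sub_mx_unit.
have M_unit : 1%:M *t Phi + kmx L *t (B *m C) \in unitmx.
  by rewrite -ME sub_mx_unit.
rewrite /M /resolvent ME.
have := tens_push_through Phi_unit M_unit; rewrite -GE.
set W := invmx (_ + _); set V := invmx (_ + _) => WE.
rewrite -[_ *m V *m _]mulmxA -WE.
rewrite !map_mxT -[kmx H in LHS]mulmx1.
rewrite -[kmx (lti_C S) in LHS]mul1mx.
rewrite -[kmx F in LHS]mul1mx -[kmx (lti_B S) in LHS]mulmx1.
by rewrite -!tensmx_mul !mulmxA.
Qed.

(** This is why a reduced agent may be replaced by a minimal realization, even
    though the order of the network changes with it. *)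
Lemma network_transfer_agent p q m N (L : 'M[R]_N) (F : 'M[R]_(N, p))
    (H : 'M[R]_(q, N)) (S1 S2 : lti R m m) :
  transfer S1 = transfer S2 ->
  transfer (network L F H S1) = transfer (network L F H S2).
Proof. by rewrite !network_transfer => ->. Qed.
End TransferEq.

(** * The dissipation inequality for the removal of one state *)

Section Dissipation.
Variables (R : realType) (n p q : nat).
Variables (A : 'M[R]_n) (B : 'M[R]_(n, p)) (C : 'M[R]_(q, n)) (d : 'rV[R]_n).
Hypothesis d_gt0 : forall i, 0 < d 0 i.
Hypothesis ctr_lmi :
  psdmx (- (A *m diag_mx d + diag_mx d *m A^T + B *m B^T)).
Hypothesis obs_lmi :
  psdmx (- (A^T *m diag_mx d + diag_mx d *m A + C^T *m C)).

Definition sqnorm k (x : 'cV[R]_k) : R := \sum_i x i 0 ^+ 2.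

Lemma sqnorm_ge0 k (x : 'cV[R]_k) : 0 <= sqnorm x.
Proof. by apply: sumr_ge0 => i _; exact: sqr_ge0. Qed.

Lemma dotE k (x y : 'cV[R]_k) : (x^T *m y) 0 0 = \sum_i x i 0 * y i 0.
Proof. by rewrite mxE; apply: eq_bigr => i _; rewrite mxE. Qed.

Lemma sqnormE k (x : 'cV[R]_k) : sqnorm x = (x^T *m x) 0 0.
Proof. by rewrite dotE; apply: eq_bigr => i _; rewrite expr2. Qed.

Lemma diag_mulE k (y : 'cV[R]_n) (i : 'I_n) :
  (diag_mx d *m y) i k = d 0 i * y i k.
Proof. by rewrite mul_diag_mx mxE. Qed.

(** Along x' = A x, the function x^T D x decreases at least at the rate
    |C x|^2; this is the observability inequality tested against x. *)
Lemma obs_dissipation (x : 'cV[R]_n) :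
  2 * (\sum_i d 0 i * x i 0 * (A *m x) i 0) + sqnorm (C *m x) <= 0.
Proof.
have [_ /(_ x)] := obs_lmi.
have -> : x^T *m - (A^T *m diag_mx d + diag_mx d *m A + C^T *m C) *m x =
  - ((A *m x)^T *m (diag_mx d *m x) + x^T *m (diag_mx d *m (A *m x))
      + (C *m x)^T *m (C *m x)).
  by rewrite mulmxN mulNmx !mulmxDr !mulmxDl !trmx_mul !mulmxA.
rewrite mxE oppr_ge0 mxE [X in X + _]mxE -sqnormE !dotE; apply: le_trans.
rewrite lerD2r mulr_natl mulr2n le_eqVlt; apply/orP; left; apply/eqP.
by congr (_ + _); apply: eq_bigr => i _; rewrite diag_mulE; ring.
Qed.

(** Along z' = A z + 2 B u with z = D y, the function z^T D^-1 z increases at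
    most at the rate 4 |u|^2: the controllability inequality bounds the drift by
    - |B^T y|^2 and the square of B^T y - 2 u is completed. *)
Lemma ctr_dissipation (y : 'cV[R]_n) (u : 'cV[R]_p) :
  2 * (\sum_i y i 0 * (A *m (diag_mx d *m y) + 2 *: (B *m u)) i 0)
    <= 4 * sqnorm u.
Proof.
have [_ /(_ y)] := ctr_lmi.
have -> : y^T *m - (A *m diag_mx d + diag_mx d *m A^T + B *m B^T) *m y =
  - (y^T *m (A *m (diag_mx d *m y)) + (A *m (diag_mx d *m y))^T *m y
      + (B^T *m y)^T *m (B^T *m y)).
  by rewrite mulmxN mulNmx !mulmxDr !mulmxDl !trmx_mul tr_diag_mx !mulmxA trmxK.
rewrite mxE oppr_ge0 mxE [X in X + _]mxE -sqnormE !dotE.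
under [X in _ + X + _]eq_bigr do rewrite mulrC.
set a := \sum_i _ => Ha.
have : 0 <= sqnorm (B^T *m y - 2 *: u) by exact: sqnorm_ge0.
have -> : sqnorm (B^T *m y - 2 *: u) =
   sqnorm (B^T *m y) - 4 * ((B^T *m y)^T *m u) 0 0 + 4 * sqnorm u.
  rewrite dotE /sqnorm !mulr_sumr -sumrN -!big_split.
  by apply: eq_bigr => i _; rewrite /= !mxE; ring.
have -> : ((B^T *m y)^T *m u) 0 0 = \sum_i y i 0 * (B *m u) i 0.
  by rewrite trmx_mul trmxK -mulmxA dotE.
have -> : \sum_i y i 0 * (A *m (diag_mx d *m y) + 2 *: (B *m u)) i 0 =
    a + 2 * \sum_i y i 0 * (B *m u) i 0.
  rewrite mulr_sumr -big_split; apply: eq_bigr => i _ /=.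
  by rewrite [X in _ * X]mxE [X in _ * (_ + X)]mxE; ring.
by set b := \sum_i _; lra.
Qed.

(** The heart of the error bound.  [x] and [xh] are the states of the systems
    that keep [l |: S], resp. [S], with velocities [v] and [vh].  Up to a
    term in the coordinate l, the difference x - xh obeys the undriven equation
    and the sum x + xh obeys the equation driven by 2 u; that term is the
    velocity w which the removed state would have in the smaller system.  It
    contributes 2 d_l x_l w to the rate of the observability storage and
    - 2 x_l w / d_l to the rate of the controllability storage, so that it
    cancels when the second one is weighted by d_l^2. *)
Lemma one_state_dissipation (S : {set 'I_n}) (l : 'I_n)
    (x xh v vh : 'cV[R]_n) (u : 'cV[R]_p) : l \notin S ->
  (forall i, v i 0 = if i \in l |: S then (A *m x + B *m u) i 0 else 0) ->
  (forall i, vh i 0 = if i \in S then (A *m xh + B *m u) i 0 else 0) ->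
  (forall i, i \notin l |: S -> x i 0 = 0) ->
  (forall i, i \notin S -> xh i 0 = 0) ->
  2 * (\sum_i d 0 i * (x - xh) i 0 * (v - vh) i 0)
    + d 0 l ^+ 2 * (2 * (\sum_i (d 0 i)^-1 * (x + xh) i 0 * (v + vh) i 0))
    + sqnorm (C *m (x - xh)) <= 4 * d 0 l ^+ 2 * sqnorm u.
Proof.
move=> lS vE vhE x0 xh0; pose w := (A *m xh + B *m u) l 0.
have dN i : d 0 i != 0 by rewrite gt_eqF.
pose y := \col_i ((d 0 i)^-1 * (x + xh) i 0).
have yE : diag_mx d *m y = x + xh.
  by apply/colP => i; rewrite diag_mulE mxE mulrA mulfV ?mul1r.
have := obs_dissipation (x - xh); have := ctr_dissipation y u; rewrite yE.
have -> : \sum_i d 0 i * (x - xh) i 0 * (v - vh) i 0 =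
    \sum_i d 0 i * (x - xh) i 0 * (A *m (x - xh)) i 0 + d 0 l * x l 0 * w.
  rewrite [in RHS](bigD1 l) //= [in LHS](bigD1 l) //= addrAC; congr (_ + _).
    rewrite ![(x - xh) _ _]mxE ![(- xh) _ _]mxE (xh0 l) // subr0.
    rewrite [(v - vh) _ _]mxE [(- vh) _ _]mxE vE vhE setU11 (negPf lS).
    by rewrite mulmxBr ![in RHS]mxE /w ![in LHS]mxE ![in RHS]mxE; ring.
  apply: eq_bigr => i il.
  rewrite [(v - vh) _ _]mxE [(- vh) _ _]mxE vE vhE !in_setU1 (negPf il) /=.
  case: ifPn => iS; last first.
    rewrite [(x - xh) _ _]mxE [(- xh) _ _]mxE x0 ?in_setU1 ?negb_or ?il //.
    by rewrite xh0 // subr0 !(mulr0, mul0r).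
  by rewrite mulmxBr ![in RHS]mxE ![in LHS]mxE; ring.
have -> : \sum_i (d 0 i)^-1 * (x + xh) i 0 * (v + vh) i 0 =
    \sum_i y i 0 * (A *m (x + xh) + 2 *: (B *m u)) i 0
      - (d 0 l)^-1 * x l 0 * w.
  rewrite [in RHS](bigD1 l) //= [in LHS](bigD1 l) //= addrAC; congr (_ + _).
    rewrite ![y _ _]mxE ![(x + xh) _ _]mxE (xh0 l) // addr0.
    rewrite [(v + vh) _ _]mxE vE vhE setU11 (negPf lS).
    by rewrite mulmxDr ![in RHS]mxE /w ![in LHS]mxE ![in RHS]mxE; ring.
  apply: eq_bigr => i il.
  rewrite [y _ _]mxE [(v + vh) _ _]mxE vE vhE !in_setU1 (negPf il) /=.
  case: ifPn => iS; last first.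
    rewrite [(x + xh) _ _]mxE x0 ?in_setU1 ?negb_or ?il //.
    by rewrite xh0 // addr0 !(mulr0, mul0r).
  by rewrite mulmxDr ![in RHS]mxE ![in LHS]mxE; ring.
set a := \sum_i _; set b := \sum_i _; set e := sqnorm (C *m _).
have -> : d 0 l ^+ 2 * (2 * (a - (d 0 l)^-1 * x l 0 * w)) =
   d 0 l ^+ 2 * (2 * a) - 2 * (d 0 l * x l 0 * w).
  by field; rewrite dN.
move=> /(ler_wpM2l (sqr_ge0 (d 0 l))); set t := d 0 l * x l 0 * w.
set t1 := d 0 l ^+ 2 * _; lra.
Qed.
End Dissipation.

(** * The error bound of balanced truncation *)

Section Balanced.
Variables (R : realType) (n p q : nat).
Local Notation C := (complex R).
Variables (A : 'M[R]_n) (B : 'M[R]_(n, p)) (Cm : 'M[R]_(q, n)) (d : 'rV[R]_n).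
Hypothesis d_gt0 : forall i, 0 < d 0 i.
Hypothesis ctr_lmi :
  psdmx (- (A *m diag_mx d + diag_mx d *m A^T + B *m B^T)).
Hypothesis obs_lmi :
  psdmx (- (A^T *m diag_mx d + diag_mx d *m A + Cm^T *m Cm)).

Definition re_mx k (x : 'cV[C]_k) : 'cV[R]_k := map_mx (@complex.Re R) x.
Definition im_mx k (x : 'cV[C]_k) : 'cV[R]_k := map_mx (@complex.Im R) x.

Lemma re_mulmx a b (M : 'M[R]_(a, b)) (x : 'cV[C]_b) :
  re_mx (cmx M *m x) = M *m re_mx x.
Proof.
apply/colP => i; rewrite !mxE (raddf_sum (@complex.Re R)); apply: eq_bigr => j _.
by rewrite !mxE; case: (x j 0) => r t; rewrite /= mul0r subr0.
Qed.

Lemma im_mulmx a b (M : 'M[R]_(a, b)) (x : 'cV[C]_b) :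
  im_mx (cmx M *m x) = M *m im_mx x.
Proof.
apply/colP => i; rewrite !mxE (raddf_sum (@complex.Im R)); apply: eq_bigr => j _.
by rewrite !mxE; case: (x j 0) => r t; rewrite /= mul0r addr0.
Qed.

Lemma re_mxD k (x y : 'cV[C]_k) : re_mx (x + y) = re_mx x + re_mx y.
Proof. exact: map_mxD. Qed.
Lemma im_mxD k (x y : 'cV[C]_k) : im_mx (x + y) = im_mx x + im_mx y.
Proof. exact: map_mxD. Qed.
Lemma re_mxB k (x y : 'cV[C]_k) : re_mx (x - y) = re_mx x - re_mx y.
Proof. exact: map_mxB. Qed.
Lemma im_mxB k (x y : 'cV[C]_k) : im_mx (x - y) = im_mx x - im_mx y.
Proof. exact: map_mxB. Qed.

Lemma csqnormE k (x : 'cV[C]_k) :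
  csqnorm x = sqnorm (re_mx x) + sqnorm (im_mx x).
Proof. by rewrite /sqnorm -big_split; apply: eq_bigr => i _; rewrite !mxE. Qed.

Lemma re_mxZ k (s : C) (x : 'cV[C]_k) :
  re_mx (s *: x) = complex.Re s *: re_mx x - complex.Im s *: im_mx x.
Proof. by apply/colP => i; rewrite !mxE; case: s (x i 0) => a b []. Qed.

Lemma im_mxZ k (s : C) (x : 'cV[C]_k) :
  im_mx (s *: x) = complex.Im s *: re_mx x + complex.Re s *: im_mx x.
Proof. by apply/colP => i; rewrite !mxE addrC; case: s (x i 0) => a b []. Qed.

Variable s : C.
Hypothesis s_gt0 : 0 < complex.Re s.

(** Truncation to the states in [S], without changing the dimension: the states
    outside [S] are frozen, hence 0 because s <> 0.  All truncations of a system
    thus live in one space and can be compared coordinatewise. *)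
Definition masked_response (S : {set 'I_n}) (u : 'cV[C]_p) (x : 'cV[C]_n) :=
  forall i, (s *: x) i 0 = if i \in S then (cmx A *m x + cmx B *m u) i 0 else 0.

Lemma s_neq0 : s != 0.
Proof. by apply: contraTneq s_gt0 => ->; rewrite ltxx. Qed.

Lemma masked_response_support S u x i :
  masked_response S u x -> i \notin S -> x i 0 = 0.
Proof.
move=> /(_ i) + iS; rewrite (negPf iS) mxE => /eqP.
by rewrite mulf_eq0 (negPf s_neq0) => /eqP.
Qed.

Lemma masked_response_re S u x : masked_response S u x ->
  forall i, re_mx (s *: x) i 0 =
    if i \in S then (A *m re_mx x + B *m re_mx u) i 0 else 0.
Proof.
move=> xE i; rewrite mxE xE -!re_mulmx -re_mxD.
by case: ifP; rewrite // [in RHS]mxE.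
Qed.

Lemma masked_response_im S u x : masked_response S u x ->
  forall i, im_mx (s *: x) i 0 =
    if i \in S then (A *m im_mx x + B *m im_mx u) i 0 else 0.
Proof.
move=> xE i; rewrite mxE xE -!im_mulmx -im_mxD.
by case: ifP; rewrite // [in RHS]mxE.
Qed.

Definition energy (w : 'rV[R]_n) (x : 'cV[C]_n) : R :=
  \sum_i w 0 i * (re_mx x i 0 ^+ 2 + im_mx x i 0 ^+ 2).

Lemma energy_ge0 (w : 'rV[R]_n) x : (forall i, 0 < w 0 i) -> 0 <= energy w x.
Proof.
by move=> w0; apply: sumr_ge0 => i _; rewrite mulr_ge0 ?addr_ge0 ?sqr_ge0 ?ltW.
Qed.

(** For x(t) = x e^(st), half the derivative of the energy is Re s times the
    energy; this is where membership of [s] in the right half-plane gives the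
    dissipation inequalities a sign. *)
Lemma energy_rate (w : 'rV[R]_n) x :
  \sum_i w 0 i * re_mx x i 0 * re_mx (s *: x) i 0
    + \sum_i w 0 i * im_mx x i 0 * im_mx (s *: x) i 0
  = complex.Re s * energy w x.
Proof.
rewrite -big_split mulr_sumr; apply: eq_bigr => i _.
by rewrite re_mxZ im_mxZ ![in LHS]mxE /= ![in RHS]mxE; ring.
Qed.

(** A mode with Re s > 0 would have growing energy, while the observability
    inequality says that the energy does not grow.  Every truncation inherits
    this, so none has a pole in the open right half-plane. *)
Lemma masked_response_unique S x : masked_response S 0 x -> x = 0.
Proof.
move=> xE; have dN i : d 0 i != 0 by rewrite gt_eqF.
have rate y v : (forall i, v i 0 = if i \in S then (A *m y + 0) i 0 else 0) ->
  (forall i, i \notin S -> y i 0 = 0) ->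
    \sum_i d 0 i * y i 0 * v i 0 = \sum_i d 0 i * y i 0 * (A *m y) i 0.
  move=> vE y0; apply: eq_bigr => i _; rewrite vE addr0.
  by case: ifPn => // /y0 ->; rewrite !(mulr0, mul0r).
have S0 i : i \notin S -> x i 0 = 0 by exact: masked_response_support xE.
have := energy_rate d x; rewrite !rate; last first.
- by move=> i iS; rewrite mxE S0.
- move=> i; rewrite (masked_response_re xE) [re_mx 0](_ : _ = 0) ?mulmx0 //.
  by apply/colP => ?; rewrite !mxE.
- by move=> i iS; rewrite mxE S0.
- move=> i; rewrite (masked_response_im xE) [im_mx 0](_ : _ = 0) ?mulmx0 //.
  by apply/colP => ?; rewrite !mxE.
have := obs_dissipation obs_lmi (re_mx x).
have := obs_dissipation obs_lmi (im_mx x).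
have := sqnorm_ge0 (Cm *m re_mx x).
have := sqnorm_ge0 (Cm *m im_mx x).
move=> h1 h2 h3 h4 hE.
have : complex.Re s * energy d x <= 0 by rewrite -hE; lra.
rewrite pmulr_rle0 // => le0.
have /eqP : energy d x = 0 by apply/eqP; rewrite eq_le le0 energy_ge0.
rewrite psumr_eq0 => [/allP x0|i _]; last first.
  by rewrite mulr_ge0 ?addr_ge0 ?sqr_ge0 ?ltW.
apply/colP => i; have := x0 i (mem_index_enum i).
rewrite /= mulf_eq0 (negPf (dN i)) /= !mxE.
case: (x i 0) => a b /=; rewrite paddr_eq0 ?sqr_ge0 // !sqrf_eq0.
by case/andP => /eqP -> /eqP ->.
Qed.

Lemma masked_response_exists S u : exists x, masked_response S u x.
Proof.
pose P : 'M[R]_n := diag_mx (\row_i (i \in S)%:R).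
have PE (y : 'cV[C]_n) i : (cmx P *m y) i 0 = if i \in S then y i 0 else 0.
  rewrite map_diag_mx mul_diag_mx !mxE.
  by case: ifP => _; rewrite /= ?mul1r ?mul0r.
have [|x xE] := @response_exists _ _ (P *m A) s (cmx P *m (cmx B *m u)).
  apply: char_poly_eval_neq0 => x xE.
  apply: (@masked_response_unique S) => i.
  by rewrite xE map_mxM -mulmxA PE mulmx0 addr0.
by exists x => i; rewrite xE map_mxM -mulmxA -mulmxDr PE.
Qed.

(** [one_state_dissipation] for the real and for the imaginary part, added: the
    rates of both storage functions become nonnegative energies and drop out. *)
Lemma one_state_bound (S : {set 'I_n}) l u x xh : l \notin S ->
  masked_response (l |: S) u x -> masked_response S u xh ->
  csqnorm (cmx Cm *m (x - xh)) <= (2 * d 0 l) ^+ 2 * csqnorm u.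
Proof.
move=> lS xE xhE; pose di : 'rV[R]_n := \row_i (d 0 i)^-1.
have di0 i : 0 < di 0 i by rewrite mxE invr_gt0.
have x_re i : i \notin l |: S -> re_mx x i 0 = 0.
  by move=> iS; rewrite mxE (masked_response_support xE iS).
have x_im i : i \notin l |: S -> im_mx x i 0 = 0.
  by move=> iS; rewrite mxE (masked_response_support xE iS).
have xh_re i : i \notin S -> re_mx xh i 0 = 0.
  by move=> iS; rewrite mxE (masked_response_support xhE iS).
have xh_im i : i \notin S -> im_mx xh i 0 = 0.
  by move=> iS; rewrite mxE (masked_response_support xhE iS).
have := one_state_dissipation d_gt0 ctr_lmi obs_lmi lS
  (masked_response_re xE) (masked_response_re xhE) x_re xh_re.
have := one_state_dissipation d_gt0 ctr_lmi obs_lmi lS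
  (masked_response_im xE) (masked_response_im xhE) x_im xh_im.
rewrite -!re_mxB -!im_mxB -!re_mxD -!im_mxD -!scalerDr -!scalerBr.
rewrite -re_mulmx -im_mulmx.
have diE (y v : 'cV[R]_n) : \sum_i (d 0 i)^-1 * y i 0 * v i 0 =
    \sum_i di 0 i * y i 0 * v i 0.
  by apply: eq_bigr => i _; rewrite mxE.
rewrite !diE; have := energy_rate d (x - xh); have := energy_rate di (x + xh).
have := mulr_ge0 (ltW s_gt0) (energy_ge0 (x - xh) d_gt0).
have := mulr_ge0 (sqr_ge0 (d 0 l))
  (mulr_ge0 (ltW s_gt0) (energy_ge0 (x + xh) di0)).
rewrite !csqnormE exprMn => pos1 + e1 e2.
rewrite -{}e2; rewrite -{}e1 in pos1 *.
set a1 := \sum_i _ in pos1 *; set a2 := \sum_i _ in pos1 *.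
set b1 := \sum_i _; set b2 := \sum_i _.
rewrite mulrDr in pos1 *; move=> pos2 h1 h2; lra.
Qed.

(** The triangle inequality in squared form.  It reduces to the termwise
    inequality a b (x + y)^2 <= (a + b) (b x^2 + a y^2). *)
Lemma csqnorm_triangle k (v w : 'cV[C]_k) (a b U : R) : 0 <= a -> 0 <= b ->
  csqnorm v <= a ^+ 2 * U -> csqnorm w <= b ^+ 2 * U ->
  csqnorm (v + w) <= (a + b) ^+ 2 * U.
Proof.
have zero (y : 'cV[C]_k) : csqnorm y <= 0 -> y = 0.
  move=> le0; have /eqP : csqnorm y = 0.
    by apply/eqP; rewrite eq_le le0 csqnorm_ge0.
  rewrite psumr_eq0 => [/allP y0|i _]; last by rewrite addr_ge0 ?sqr_ge0.
  apply/colP => i; have := y0 i (mem_index_enum i); rewrite /= mxE.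
  case: (y i 0) => c e /=; rewrite paddr_eq0 ?sqr_ge0 // !sqrf_eq0.
  by case/andP => /eqP -> /eqP ->.
rewrite le_eqVlt => /predU1P[<-|a0].
  by rewrite expr0n mul0r => _ /zero -> ; rewrite !add0r.
rewrite le_eqVlt => /predU1P[<-|b0].
  by rewrite expr0n mul0r => + /zero ->; rewrite !addr0.
move=> le_v le_w; rewrite -(ler_pM2l (mulr_gt0 a0 b0)).
apply: (@le_trans _ _ ((a + b) * (b * csqnorm v + a * csqnorm w))).
  rewrite /csqnorm !mulr_sumr -big_split !mulr_sumr; apply: ler_sum => i _.
  rewrite mxE; case: (v i 0) (w i 0) => c e [f g] /=.
  rewrite -subr_ge0 (_ : _ - _ = (b * c - a * f) ^+ 2 + (b * e - a * g) ^+ 2).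
    by rewrite addr_ge0 ?sqr_ge0.
  by ring.
rewrite (_ : a * b * _ = (a + b) * (b * (a ^+ 2 * U) + a * (b ^+ 2 * U))).
  apply: ler_wpM2l; first by rewrite addr_ge0 // ltW.
  by apply: lerD; apply: ler_wpM2l => //; exact: ltW.
by ring.
Qed.

(** Remove the states of T that are not in S one at a time; each removal happens
    in a system that still satisfies the two inequalities with the same D, which
    is why the individual errors add up. *)
Lemma masked_bound (S T : {set 'I_n}) u x xh : S \subset T ->
  masked_response T u x -> masked_response S u xh ->
  csqnorm (cmx Cm *m (x - xh)) <=
    (2 * \sum_(i in T :\: S) d 0 i) ^+ 2 * csqnorm u.
Proof.
move: {2}(#|_|) (erefl #|T :\: S|) => k; elim: k T x => [|k IH] T x.
  move/eqP; rewrite cards_eq0 finset.setD_eq0 => TS ST.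
  have -> : T = S by apply/eqP; rewrite finset.eqEsubset TS.
  move=> xE xhE; rewrite finset.setDv big_set0 mulr0 expr0n mul0r.
  have -> : x - xh = 0.
    apply: (@masked_response_unique S) => i.
    rewrite scalerBr mxE [X in _ + X]mxE xE xhE.
    case: ifP => _; last by rewrite subrr.
    by rewrite mulmx0 addr0 mulmxBr !mxE opprD addrACA subrr addr0.
  by rewrite mulmx0 /csqnorm big1 // => i _; rewrite mxE /= expr0n addr0.
move=> cardTS ST xE xhE.
have /set0Pn[l] : T :\: S != finset.set0 by rewrite -card_gt0 cardTS.
rewrite inE => /andP[lS lT].
have [y yE] := masked_response_exists (T :\ l) u.
have TE : T :\: S = l |: (T :\ l :\: S).
  apply/finset.setP => i; rewrite !inE; case: eqP => [->|] //=.
  by rewrite lS lT.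
have lTS : l \notin T :\ l :\: S by rewrite !inE eqxx andbF.
have STl : S \subset T :\ l.
  by rewrite finset.subsetD1 ST.
have cardl : #|T :\ l :\: S| = k.
  by move: cardTS; rewrite TE cardsU1 lTS add1n => -[].
rewrite TE big_setU1 //= mulrDr.
have -> : x - xh = (x - y) + (y - xh) by rewrite addrA subrK.
rewrite mulmxDr; apply: csqnorm_triangle; last exact: IH.
- by rewrite mulr_ge0 // ltW.
- by rewrite mulr_ge0 // sumr_ge0 // => i _; rewrite ltW.
- apply: (@one_state_bound (T :\ l)) => //; first by rewrite !inE eqxx.
  by rewrite finset.setD1K.
Qed.

Variables (k : nat) (f : 'I_k -> 'I_n).
Hypothesis f_inj : injective f.

Definition extend (x : 'cV[C]_k) : 'cV[C]_n := colsub f 1%:M *m x.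

Lemma extendE x j : extend x (f j) 0 = x j 0.
Proof.
rewrite mxE (bigD1 j) //= !mxE eqxx mul1r big1 ?addr0 // => i ij.
by rewrite !mxE (inj_eq f_inj) eq_sym (negPf ij) mul0r.
Qed.

Lemma extend_out x i : i \notin codom f -> extend x i 0 = 0.
Proof.
move=> fi; rewrite mxE big1 // => j _; rewrite !mxE.
by case: eqP fi => [->|]; rewrite ?codom_f ?mul0r.
Qed.

Lemma mul_extend a (M : 'M[R]_(a, n)) x :
  cmx M *m extend x = cmx (colsub f M) *m x.
Proof. by rewrite mulmxA mulmx_colsub mulmx1 map_mxsub. Qed.

Lemma truncated_response (u : 'cV[C]_p) (x : 'cV[C]_k) :
  s *: x = cmx (mxsub f f A) *m x + cmx (rowsub f B) *m u ->
  masked_response [set i in codom f] u (extend x).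
Proof.
move=> xE i; rewrite inE; case: ifPn => [/codomP[j ->]|fi].
  rewrite mxE extendE; have := congr1 (fun M : 'cV_k => M j 0) xE.
  rewrite mxE => ->; rewrite mul_extend [LHS]mxE [RHS]mxE; congr (_ + _).
    by rewrite [LHS]mxE [RHS]mxE; apply: eq_bigr => l _; rewrite !mxE.
  by rewrite [LHS]mxE [RHS]mxE; apply: eq_bigr => l _; rewrite !mxE.
by rewrite mxE extend_out ?mulr0.
Qed.

End Balanced.

(** The coordinates in the range of [f] are kept; the others are summed with
    multiplicity, as [masked_bound] removes them one by one. *)
Theorem Hinf_balanced_truncation (R : realType) (n p q k : nat)
    (A : 'M[R]_n) (B : 'M[R]_(n, p)) (Cm : 'M[R]_(q, n)) (d : 'rV[R]_n)
    (f : 'I_k -> 'I_n) :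
  (forall i, 0 < d 0 i) ->
  psdmx (- (A *m diag_mx d + diag_mx d *m A^T + B *m B^T)) ->
  psdmx (- (A^T *m diag_mx d + diag_mx d *m A + Cm^T *m Cm)) ->
  injective f ->
  (Hinf_norm (transfer (LTI A B Cm)
      - transfer (LTI (mxsub f f A) (rowsub f B) (colsub f Cm)))
    <= (2 * \sum_(i | i \notin codom f) d 0 i)%:E)%E.
Proof.
move=> d_gt0 ctr obs f_inj; apply: Hinf_norm_le => /=.
  by rewrite mulr_ge0 // sumr_ge0 // => i _; rewrite ltW.
move=> s s0; have full u (x : 'cV_n) :
    s *: x = cmx A *m x + cmx B *m u ->
    masked_response A B s [set: 'I_n] u x.
  by move=> xE i; rewrite inE xE.
split=> [x xE|x xE|u x1 x2 xE1 xE2].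
- apply: (masked_response_unique (B := B) d_gt0 obs s0 (S := [set: 'I_n])).
  by apply: full; rewrite mulmx0 addr0.
- have x0 : extend f x = 0.
    apply: (masked_response_unique (B := B) d_gt0 obs s0).
    by apply: truncated_response => //; rewrite xE mulmx0 addr0.
  by apply/colP => j; rewrite -(extendE f_inj) x0 !mxE.
rewrite -mul_extend -mulmxBr.
have -> : \sum_(i | i \notin codom f) d 0 i =
    \sum_(i in [set: 'I_n] :\: [set i in codom f]) d 0 i.
  by apply: eq_bigl => i; rewrite !inE andbT.
apply: (masked_bound d_gt0 ctr obs s0); first exact: finset.subsetT.
  exact: full.
exact: truncated_response.
Qed.

(** * Semidefinite Kronecker products *)

Section PSD.
Variable R : realType.

Lemma psdmxD n (M N : 'M[R]_n) : psdmx M -> psdmx N -> psdmx (M + N).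
Proof.
move=> [Ms M0] [Ns N0]; split=> [|x]; first by rewrite linearD /= Ms Ns.
by rewrite mulmxDr mulmxDl mxE addr_ge0.
Qed.

Lemma psdmx_congr n k (M : 'M[R]_n) (E : 'M[R]_(k, n)) :
  psdmx M -> psdmx (E *m M *m E^T).
Proof.
move=> [Ms M0]; split=> [|x]; first by rewrite !trmx_mul trmxK Ms mulmxA.
have := M0 (E^T *m x); rewrite trmx_mul trmxK.
by rewrite !mulmxA.
Qed.

Lemma sum_mxtens a b (F : 'I_(a * b) -> R) :
  \sum_k F k = \sum_i \sum_j F (mxtens_index (i, j)).
Proof.
rewrite pair_big /= (reindex (@mxtens_index a b)) /=.
  by apply: eq_bigr => -[i j].
exists (@mxtens_unindex a b) => ? _; [exact: mxtens_indexK|exact: mxtens_unindexK].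
Qed.

(** The quadratic form of the product splits along the blocks of x into copies
    of the form of M weighted by d. *)
Lemma psdmx_diag_tens a b (d : 'rV[R]_a) (M : 'M[R]_b) :
  (forall i, 0 <= d 0 i) -> psdmx M -> psdmx (diag_mx d *t M).
Proof.
move=> d0 [Ms M0]; split=> [|x]; first by rewrite trmx_tens tr_diag_mx Ms.
rewrite -mulmxA dotE sum_mxtens; apply: sumr_ge0 => i _.
pose xi := \col_j x (mxtens_index (i, j)) 0.
have := mulr_ge0 (d0 i) (M0 xi); rewrite -mulmxA dotE mulr_sumr.
congr (0 <= _); apply: eq_bigr => j _; rewrite [xi _ _]mxE mulrCA; congr (_ * _).
rewrite [in RHS]mxE sum_mxtens (bigD1 i) //= [X in _ + X]big1 ?addr0 => [|k ki].
  by rewrite mxE mulr_sumr; apply: eq_bigr => l _; rewrite tensmxE !mxE eqxx mulrA.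
by rewrite big1 // => l _; rewrite tensmxE mxE eq_sym (negPf ki) !mul0r.
Qed.

Lemma psdmx_tens_1 a b (M : 'M[R]_a) : psdmx M -> psdmx (M *t (1%:M : 'M_b)).
Proof.
move=> [Ms M0]; split=> [|x]; first by rewrite trmx_tens trmx1 Ms.
rewrite -mulmxA dotE sum_mxtens exchange_big; apply: sumr_ge0 => j _.
pose xj := \col_i x (mxtens_index (i, j)) 0.
have := M0 xj; rewrite -mulmxA dotE.
congr (0 <= _); apply: eq_bigr => i _; rewrite [xj _ _]mxE; congr (_ * _).
rewrite mxE [in RHS]mxE sum_mxtens; apply: eq_bigr => k _.
rewrite (bigD1 j) //= big1 ?addr0 => [|l lj].
  by rewrite tensmxE !mxE eqxx mulr1.
by rewrite tensmxE !mxE eq_sym (negPf lj) mulr0 mul0r.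
Qed.

(** M (x) G G^T is the congruence of M (x) I by I (x) G; this avoids a square
    root of the second factor. *)
Lemma psdmx_tens_gram a b c (M : 'M[R]_a) (G : 'M[R]_(b, c)) :
  psdmx M -> psdmx (M *t (G *m G^T)).
Proof.
move=> /(@psdmx_tens_1 _ c)/(@psdmx_congr _ _ _ (1%:M *t G)).
by rewrite trmx_tens trmx1 !tensmx_mul mul1mx !mulmx1.
Qed.

End PSD.

(** * Gramians and truncation of the network *)

Section NetworkLMI.
Variables (R : realType) (N n m p q : nat).
Variables (L : 'M[R]_N) (F : 'M[R]_(N, p)) (H : 'M[R]_(q, N)).
Variables (A : 'M[R]_n) (B : 'M[R]_(n, m)) (C : 'M[R]_(m, n)).
Variables (sigma : 'rV[R]_N) (tau : 'rV[R]_n).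
Hypothesis sigma_ge0 : forall i, 0 <= sigma 0 i.

Let netA := 1%:M *t A - L *t (B *m C).

(** The network matrix enters the dynamics as - L, whence the signs in the first
    hypothesis.  With C D = B^T, D = diag tau and X = diag sigma, the coupling
    - L (x) B C turns into - (L X) (x) B B^T and matches the input term, so the
    Lyapunov expression of the network is a sum of Kronecker products of one
    network factor and one agent factor. *)
Lemma network_ctr_lmi :
  psdmx (L *m diag_mx sigma + diag_mx sigma *m L^T - F *m F^T) ->
  psdmx (- (A *m diag_mx tau + diag_mx tau *m A^T)) ->
  C *m diag_mx tau = B^T ->
  psdmx (- (netA *m diag_mx (tens_diag sigma tau)
            + diag_mx (tens_diag sigma tau) *m netA^T
            + (F *t B) *m (F *t B)^T)).
Proof.
move=> LX AK CB; have BC : diag_mx tau *m C^T = B.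
  by rewrite -[B]trmxK -CB trmx_mul tr_diag_mx.
have := psdmxD (psdmx_diag_tens sigma_ge0 AK) (psdmx_tens_gram B LX).
congr psdmx; rewrite -tens_diag_mx /netA linearB /= !trmx_tens trmx1 trmx_mul.
rewrite mulmxBl mulmxBr !tensmx_mul mul1mx mulmx1 -!mulmxA CB.
rewrite [diag_mx tau *m (C^T *m _)]mulmxA BC.
rewrite !tensmxDl tensmxNr tensmxDr tensmxNl !opprD !opprK.
by rewrite [in RHS]addrACA -!addrA.
Qed.

(** The dual computation, in which B^T D = C turns the coupling into
    - (X L) (x) C^T C. *)
Lemma network_obs_lmi :
  psdmx (L^T *m diag_mx sigma + diag_mx sigma *m L - H^T *m H) ->
  psdmx (- (A^T *m diag_mx tau + diag_mx tau *m A)) ->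
  B^T *m diag_mx tau = C ->
  psdmx (- (netA^T *m diag_mx (tens_diag sigma tau)
            + diag_mx (tens_diag sigma tau) *m netA
            + (H *t C)^T *m (H *t C))).
Proof.
move=> LY AK CB; have BC : diag_mx tau *m B = C^T.
  by rewrite -CB trmx_mul tr_diag_mx trmxK.
have := psdmxD (psdmx_diag_tens sigma_ge0 AK) (psdmx_tens_gram C^T LY).
congr psdmx; rewrite -tens_diag_mx /netA linearB /= !trmx_tens trmx1 trmx_mul.
rewrite mulmxBl mulmxBr !tensmx_mul mul1mx mulmx1 -!mulmxA CB trmxK.
rewrite [diag_mx tau *m (B *m _)]mulmxA BC.
rewrite !tensmxDl tensmxNr tensmxDr tensmxNl !opprD !opprK.
by rewrite [in RHS]addrACA -!addrA.
Qed.
End NetworkLMI.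

Section NetworkTruncation.
Variable R : realType.

Lemma posdefmx_unit n (K : 'M[R]_n) : posdefmx K -> K \in unitmx.
Proof.
move=> [_ K0]; rewrite unitmxE unitfE; apply/det0P => -[v v0 vK].
have := K0 v^T; rewrite trmx_eq0 => /(_ v0).
by rewrite trmxK vK mul0mx mxE ltxx.
Qed.

Lemma posdefmx_diag_gt0 n (K T : 'M[R]_n) (d : 'rV[R]_n) :
  posdefmx K -> T \in unitmx -> T *m K *m T^T = diag_mx d ->
  forall i, 0 < d 0 i.
Proof.
move=> [_ K0] T_unit TK i; have := K0 (row i T)^T.
have -> : ((row i T)^T)^T *m K *m (row i T)^T = row i (col i (diag_mx d)).
  by rewrite trmxK tr_row -TK !rowE !colE !mulmxA.
rewrite !mxE eqxx mulr1n; apply; rewrite trmx_eq0; apply/eqP => Ti0.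
have /matrixP/(_ 0 i)/eqP : row i T *m invmx T = 0 by rewrite Ti0 mul0mx.
by rewrite -row_mul mulmxV // !mxE eqxx oner_eq0.
Qed.

Definition tens_widen N n k r (le_k : (k <= N)%N) (le_r : (r <= n)%N)
    (j : 'I_(k * r)) : 'I_(N * n) :=
  mxtens_index
    (widen_ord le_k (mxtens_unindex j).1, widen_ord le_r (mxtens_unindex j).2).

(** Truncating the network and the agents separately keeps exactly the states
    (i, j) with i < k and j < r of the full network. *)
Lemma network_truncation N n m p q k r (le_k : (k <= N)%N) (le_r : (r <= n)%N)
    (L : 'M[R]_N) (F : 'M[R]_(N, p)) (H : 'M[R]_(q, N)) (A : 'M[R]_n)
    (B : 'M[R]_(n, m)) (C : 'M[R]_(m, n)) :
  let f := tens_widen le_k le_r in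
  let G := network L F H (LTI A B C) in
  network (mxsub (widen_ord le_k) (widen_ord le_k) L)
    (rowsub (widen_ord le_k) F) (colsub (widen_ord le_k) H)
    (LTI (mxsub (widen_ord le_r) (widen_ord le_r) A)
       (rowsub (widen_ord le_r) B) (colsub (widen_ord le_r) C)) =
  LTI (mxsub f f (lti_A G)) (rowsub f (lti_B G)) (colsub f (lti_C G)).
Proof.
move=> f G; rewrite /network /= -mxsub_mul; congr LTI.
- by apply/matrixP => i j; rewrite !mxE !mxtens_indexK /=.
- by apply/matrixP => i j; rewrite !mxE !mxtens_indexK /=.
- by apply/matrixP => i j; rewrite !mxE !mxtens_indexK /=.
Qed.

Lemma tens_widen_inj N n k r (le_k : (k <= N)%N) (le_r : (r <= n)%N) :
  injective (tens_widen le_k le_r).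
Proof.
move=> a b /(can_inj (@mxtens_indexK _ _)) [e1 e2].
apply: (can_inj (@mxtens_unindexK _ _)).
rewrite [LHS]surjective_pairing [RHS]surjective_pairing.
by congr (_, _); apply: val_inj.
Qed.

Lemma sum_discarded N n k r (le_k : (k <= N)%N) (le_r : (r <= n)%N)
    (sigma : 'rV[R]_N) (tau : 'rV[R]_n) :
  \sum_(i | i \notin codom (tens_widen le_k le_r)) tens_diag sigma tau 0 i =
  \sum_(i < N | (k <= i)%N) \sum_(j < n) sigma 0 i * tau 0 j +
  \sum_(i < N | (i < k)%N) \sum_(j < n | (r <= j)%N) sigma 0 i * tau 0 j.
Proof.
set f := tens_widen le_k le_r.
rewrite big_mkcond sum_mxtens (bigID (fun i : 'I_N => (k <= i)%N)) /=.
have fE i j : (mxtens_index (i, j) \in codom f) = (i < k)%N && (j < r)%N.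
  apply/codomP/andP => [[l /(can_inj (@mxtens_indexK _ _))[-> ->]]|[ik jr]].
    by split; [exact: mxtens_index_proof1 l | exact: mxtens_index_proof2 l].
  exists (mxtens_index (Ordinal ik, Ordinal jr)).
  by rewrite /f /tens_widen mxtens_indexK; congr (mxtens_index (_, _)); apply: val_inj.
congr (_ + _).
  apply: eq_bigr => i ki; apply: eq_bigr => j _.
  by rewrite fE ltnNge ki mxE mxtens_indexK.
apply: eq_big => [i|i ki]; first by rewrite -ltnNge.
rewrite [RHS]big_mkcond; apply: eq_bigr => j _.
by rewrite fE ltnNge ki -leqNgt mxE mxtens_indexK.
Qed.

End NetworkTruncation.

(* N = N1 + 1 and k = k1 + 1. *)
Theorem corollary16 (R : realType) (N1 k1 n r m p q : nat)
  (* agents *)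
  (A : 'M[R]_n) (B : 'M[R]_(n, m)) (C : 'M[R]_(m, n))
  (agent_minimal : minimal (LTI A B C))
  (agent_passive : passive (LTI A B C))
  (Km KM : 'M[R]_n)
  (Km_min : @minimum_certificate R m (LTI A B C) Km)
  (KM_max : @maximum_certificate R m (LTI A B C) KM)
  (* network and its spectral decomposition *)
  (L : 'M[R]_(N1 + 1)) (F : 'M[R]_(N1 + 1, p)) (H : 'M[R]_(q, N1 + 1))
  (L_laplacian : connected_laplacian L)
  (s : nat) (mult : 'I_s -> nat) (lam : 'I_s -> R)
  (mult_gt0 : forall i, (0 < mult i)%N)
  (sum_mult : (\sum_(i < s) mult i)%N = N1)
  (lam_gt0 : forall i, 0 < lam i)
  (lam_decr : forall i j : 'I_s, (i < j)%N -> lam j < lam i)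
  (Lam : 'M[R]_N1)
  (Lam_def : Lam = castmx (sum_mult, sum_mult) (\mxdiag_(i < s) (lam i)%:M))
  (T1 : 'M[R]_(N1 + 1, N1)) (T2 : 'cV[R]_(N1 + 1))
  (T2_def : T2 = (Num.sqrt (N1 + 1)%:R)^-1 *: ones R (N1 + 1))
  (T_orthogonal : row_mx T1 T2 *m (row_mx T1 T2)^T = 1%:M)
  (L_spectral :
     L = row_mx T1 T2 *m block_mx Lam 0 0 0 *m (row_mx T1 T2)^T)
  (Fbar : 'M[R]_(N1, p)) (Fbar_def : Fbar = T1^T *m F)
  (Hbar : 'M[R]_(q, N1)) (Hbar_def : Hbar = H *m T1)
  (* balancing *)
  (X : 'M[R]_N1) (X_posdef : posdefmx X)
  (X_eq : - (Lam *m X) - X *m Lam + Fbar *m Fbar^T = 0)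
  (Yblock : forall i : 'I_s, 'M[R]_(mult i))
  (Yblock_posdef : forall i, posdefmx (Yblock i))
  (Y : 'M[R]_N1)
  (Y_def : Y = castmx (sum_mult, sum_mult) (\mxdiag_(i < s) Yblock i))
  (Y_ineq : loewner_le (- (Lam *m Y) - Y *m Lam + Hbar^T *m Hbar) 0)
  (TG : 'M[R]_N1) (TG_unit : TG \in unitmx)
  (sigma : 'rV[R]_N1) (sigma_noninc : nonincreasing_diag sigma)
  (X_balanced : TG *m X *m TG^T = diag_mx sigma)
  (Y_balanced : (invmx TG)^T *m Y *m invmx TG = diag_mx sigma)
  (TD : 'M[R]_n) (TD_unit : TD \in unitmx)
  (tau : 'rV[R]_n) (tau_noninc : nonincreasing_diag tau)
  (KM_balanced : TD *m invmx KM *m TD^T = diag_mx tau)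
  (Km_balanced : (invmx TD)^T *m Km *m invmx TD = diag_mx tau)
  (* truncation *)
  (le_k1 : (k1 <= N1)%N) (le_r : (r <= n)%N)
  (Lamhat1 : 'M[R]_k1) (Fhat1 : 'M[R]_(k1, p)) (Hhat1 : 'M[R]_(q, k1))
  (Lamhat1_def :
     Lamhat1 = mxsub (widen_ord le_k1) (widen_ord le_k1) (TG *m Lam *m invmx TG))
  (Fhat1_def : Fhat1 = rowsub (widen_ord le_k1) (TG *m Fbar))
  (Hhat1_def : Hhat1 = colsub (widen_ord le_k1) (Hbar *m invmx TG))
  (agenthat : lti R m m)
  (agent_truncation :
     same_or_minimal_realization (truncation le_r TD A B C) agenthat)
  (* reduced network *)
  (Tn : 'M[R]_(k1 + 1)) (Tn_unit : Tn \in unitmx)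
  (Lhat : 'M[R]_(k1 + 1)) (Fhat : 'M[R]_(k1 + 1, p)) (Hhat : 'M[R]_(q, k1 + 1))
  (Lhat_def : Lhat = invmx Tn *m block_mx Lamhat1 0 0 0 *m Tn)
  (Fhat_def :
     Fhat = invmx Tn *m
       col_mx Fhat1 ((Num.sqrt (N1 + 1)%:R)^-1 *: ((ones R (N1 + 1))^T *m F)))
  (Hhat_def :
     Hhat =
       row_mx Hhat1 ((Num.sqrt (N1 + 1)%:R)^-1 *: (H *m ones R (N1 + 1))) *m Tn)
  (Lhat_laplacian : connected_laplacian Lhat)
  (no_average : H *m ones R (N1 + 1) = 0 \/ (ones R (N1 + 1))^T *m F = 0) :
  let Sigma := network L F H (LTI A B C) in
  let Sigmahat := network Lhat Fhat Hhat agenthat in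
  let Sigma_s := network Lam Fbar Hbar (LTI A B C) in
  let Sigmahat_s := network Lamhat1 Fhat1 Hhat1 agenthat in
  let gamma :=
    2 * (\sum_(i < N1 | (k1 <= i)%N) \sum_(j < n) sigma 0 i * tau 0 j) +
    2 * (\sum_(i < N1 | (i < k1)%N) \sum_(j < n | (r <= j)%N)
           sigma 0 i * tau 0 j) in
  Hinf_norm (transfer Sigma - transfer Sigmahat) =
    Hinf_norm (transfer Sigma_s - transfer Sigmahat_s) /\
  (Hinf_norm (transfer Sigma_s - transfer Sigmahat_s) <= gamma%:E)%E.
Proof.
have transfer_hat : transfer agenthat = transfer (truncation le_r TD A B C).
  by case: agent_truncation.
have TTt : T1 *m T1^T + T2 *m T2^T = 1%:M.
  by move: T_orthogonal; rewrite tr_row_mx mul_row_col.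
have T1T1 : T1^T *m T1 = 1%:M.
  have := mulmx1C T_orthogonal; rewrite tr_row_mx mul_col_row scalar_mx_block.
  by case/eq_block_mx.
have LE : L = T1 *m Lam *m T1^T.
  by rewrite L_spectral tr_row_mx mul_row_block !mulmx0 !addr0 mul_row_col
       mul0mx addr0.
have Lam_sym : Lam^T = Lam.
  rewrite Lam_def trmx_cast tr_mxdiag; congr castmx.
  by apply: eq_mxdiag => i; rewrite tr_scalar_mx.
have avg_out : H *m ones R (N1 + 1) = 0 -> H *m T2 = 0.
  by move=> H0; rewrite T2_def -scalemxAr H0 scaler0.
have avg_in : (ones R (N1 + 1))^T *m F = 0 -> T2^T *m F = 0.
  by move=> F0; rewrite T2_def linearZ /= -scalemxAl F0 scaler0.
move=> Sigma Sigmahat Sigma_s Sigmahat_s gamma.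
(* The average mode T2 is unobservable or uncontrollable: accordingly T1^T is a
   quotient map of the states, or T1 an inclusion. *)
have SigmaE : transfer Sigma = transfer Sigma_s.
  case: no_average => [/avg_out H0|/avg_in F0].
    apply/esym/(@network_intertwine _ _ _ _ _ _ _ _ _ _ _ _ _ _ T1^T 1%:M);
      rewrite ?mulmx1 ?mul1mx //.
      by rewrite LE !mulmxA T1T1 mul1mx.
    by rewrite Hbar_def -mulmxA (canRL (addrK _) TTt) mulmxBr mulmx1 mulmxA H0
         mul0mx subr0.
  apply: (@network_intertwine _ _ _ _ _ _ _ _ _ _ _ _ _ _ T1 1%:M);
    rewrite ?mulmx1 ?mul1mx //.
    by rewrite LE -!mulmxA T1T1 mulmx1.
  by rewrite Fbar_def mulmxA (canRL (addrK _) TTt) mulmxBl mul1mx -mulmxA F0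
       mulmx0 subr0.
have SigmahatE : transfer Sigmahat = transfer Sigmahat_s.
  case: no_average => [H0|F0].
    apply/esym/(@network_intertwine _ _ _ _ _ _ _ _ _ _ _ _ _ _
      (row_mx 1%:M 0 *m Tn) 1%:M); rewrite ?mulmx1 ?mul1mx //.
    - rewrite Lhat_def !mulmxA (mulmxK Tn_unit) mul_mx_row mul_row_block.
      by rewrite mulmx1 !mulmx0 mul1mx !addr0.
    - by rewrite Fhat_def -mulmxA mulKVmx // mul_row_col mul1mx mul0mx addr0.
    - by rewrite Hhat_def H0 scaler0 mulmxA mul_mx_row mulmx1 mulmx0.
  apply: (@network_intertwine _ _ _ _ _ _ _ _ _ _ _ _ _ _
    (invmx Tn *m col_mx 1%:M 0) 1%:M); rewrite ?mulmx1 ?mul1mx //.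
  - rewrite Lhat_def -!mulmxA (mulKVmx Tn_unit) mul_block_col mul_col_mx.
    by rewrite !mulmx1 !mul1mx !mulmx0 !mul0mx !addr0.
  - by rewrite Fhat_def F0 scaler0 -mulmxA mul_col_mx mul1mx mul0mx.
  - rewrite Hhat_def -mulmxA mulKVmx // mul_row_col mulmx1 mulmx0.
    by rewrite addr0.
split; first by rewrite SigmaE SigmahatE.
have [[Km_pos Km_lmi Km_out] _] := Km_min.
have [[KM_pos KM_lmi KM_out] _] := KM_max.
rewrite /= in Km_pos Km_lmi Km_out KM_pos KM_lmi KM_out.
have KM_unit := posdefmx_unit KM_pos.
(* From here on everything is expressed in the balanced coordinates, where
   sigma (x) tau is the diagonal of both generalized Gramians. *)
have sigma_gt0 := posdefmx_diag_gt0 X_posdef TG_unit X_balanced.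
have tau_gt0 : forall i, 0 < tau 0 i.
  apply: (posdefmx_diag_gt0 Km_pos (T := (invmx TD)^T)).
    by rewrite unitmx_tr unitmx_inv.
  by rewrite trmxK.
pose Lb := TG *m Lam *m invmx TG; pose Fb := TG *m Fbar.
pose Hb := Hbar *m invmx TG; pose Ab := TD *m A *m invmx TD.
pose Bb := TD *m B; pose Cb := C *m invmx TD.
have TGK := mulVmx TG_unit; have TDK := mulVmx TD_unit.
have -> : transfer Sigma_s = transfer (network Lb Fb Hb (LTI Ab Bb Cb)).
  apply: (@network_intertwine _ _ _ _ _ _ _ _ _ _ _ _ (LTI A B C)
    (LTI Ab Bb Cb) (invmx TG) (invmx TD)) => //=.
  - by rewrite /Lb !mulmxA TGK mul1mx.
  - by rewrite /Fb mulKmx.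
  - by rewrite /Ab !mulmxA TDK mul1mx.
  - by rewrite /Bb mulKmx.
have -> : transfer Sigmahat_s = transfer (network Lamhat1 Fhat1 Hhat1
    (truncation le_r TD A B C)) by exact: network_transfer_agent.
rewrite Lamhat1_def Fhat1_def Hhat1_def /truncation network_truncation.
have -> : gamma = 2 * \sum_(i | i \notin codom (tens_widen le_k1 le_r))
    tens_diag sigma tau 0 i.
  by rewrite sum_discarded mulrDr.
have KM_sym : (invmx KM)^T = invmx KM by rewrite trmx_inv KM_pos.1.
apply: Hinf_balanced_truncation => [i|||].
- by rewrite mxE mulr_gt0.
- apply: network_ctr_lmi => [i|||]; first exact: ltW.
  + have LbX : Lb *m diag_mx sigma = TG *m (Lam *m X) *m TG^T.
      by rewrite -X_balanced /Lb !mulmxA mulmxKV // !mulmxA.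
    have -> : diag_mx sigma *m Lb^T = TG *m (X *m Lam) *m TG^T.
      rewrite -[diag_mx sigma]tr_diag_mx -trmx_mul LbX !trmx_mul trmxK.
      by rewrite Lam_sym X_posdef.1 !mulmxA.
    have -> : Fb *m Fb^T = TG *m (Fbar *m Fbar^T) *m TG^T.
      by rewrite /Fb trmx_mul !mulmxA.
    rewrite LbX -!mulmxDl -!mulmxDr -mulNmx -mulmxN -mulmxDl -mulmxDr.
    rewrite (_ : _ + _ - _ = 0); last first.
      by apply: oppr_inj; rewrite oppr0 -X_eq !opprD opprK.
    by rewrite mulmx0 mul0mx; split=> [|x]; rewrite ?trmx0 // mulmx0 mul0mx mxE.
  + have AbK : Ab *m diag_mx tau = TD *m (A *m invmx KM) *m TD^T.
      by rewrite -KM_balanced /Ab !mulmxA mulmxKV // !mulmxA.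
    have := psdmx_congr (TD *m invmx KM) KM_lmi; congr psdmx.
    have -> : diag_mx tau *m Ab^T = (Ab *m diag_mx tau)^T.
      by rewrite [in RHS]trmx_mul tr_diag_mx.
    rewrite AbK sub0r mulmxN mulNmx; congr (- _).
    rewrite addrC mulmxDr mulmxDl !trmx_mul !trmxK KM_sym !mulmxA.
    by rewrite (mulmxKV KM_unit) (mulmxK KM_unit).
  + by rewrite -KM_balanced /Cb /Bb !mulmxA mulmxKV // KM_out mulmxK // trmx_mul.
- apply: network_obs_lmi => [i|||]; first exact: ltW.
  + have := psdmx_congr (invmx TG)^T Y_ineq; congr psdmx.
    have LbY : diag_mx sigma *m Lb = (invmx TG)^T *m (Y *m Lam) *m invmx TG.
      by rewrite -Y_balanced /Lb !mulmxA mulmxKV.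
    have Ysym : Y^T = Y.
      rewrite Y_def trmx_cast tr_mxdiag; congr castmx.
      by apply: eq_mxdiag => i; case: (Yblock_posdef i).
    have -> : Lb^T *m diag_mx sigma = (diag_mx sigma *m Lb)^T.
      by rewrite [in RHS]trmx_mul tr_diag_mx.
    rewrite LbY !trmx_mul !trmxK Ysym Lam_sym sub0r !opprD !opprK !mulmxDr !mulmxDl.
    by rewrite mulmxN mulNmx /Hb !mulmxA.
  + have := psdmx_congr (invmx TD)^T Km_lmi; congr psdmx.
    have AbK : diag_mx tau *m Ab = (invmx TD)^T *m (Km *m A) *m invmx TD.
      by rewrite -Km_balanced /Ab !mulmxA mulmxKV.
    have -> : Ab^T *m diag_mx tau = (diag_mx tau *m Ab)^T.
      by rewrite [in RHS]trmx_mul tr_diag_mx.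
    rewrite AbK !trmx_mul !trmxK Km_pos.1 sub0r mulmxN mulNmx; congr (- _).
    by rewrite mulmxDr mulmxDl !mulmxA.
  + rewrite -Km_balanced /Cb /Bb Km_out trmx_mul !mulmxA.
    by rewrite -(mulmxA _ TD^T) -trmx_mul TDK trmx1 mulmx1.
- exact: tens_widen_inj.
Qed.
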